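(* Let $p\ge 5$ be an odd prime, and let $g$ be the multiplicative order of $2$ in $\mathbb{Z}_p^*$. Let $n=2^{c}+2^{b}+2^{a}$ where $c>b>a\ge 0$ are integers. If $\{a,b,c\}\equiv\{g-2,g-2,g-1\} \bmod g$ (as multisets of residues modulo $g$), then $2^{c}$, $2^{b}$ and $2^{a}$ are non-essential for $n$ in base $p$. Furthermore, the element $3$ is non-essential for $n$ in both base $2$ and base $p$. Hence $\Phi_{2p}$ is a factor of $Q_{n}(t)$.
   Context: For $S\subseteq[n-1]=\{1,\dots,n-1\}$ let $\beta_n(S)$ be the number of permutations $\pi\in\mathfrak{S}_n$ with descent set $\{i\in[n-1] : \pi_i>\pi_{i+1}\}$ equal to $S$. The $n$th descent set polynomial is $Q_n(t)=\sum_{S\subseteq[n-1]}t^{\beta_n(S)}$. $\Phi_m(t)$ denotes the $m$th cyclotomic polynomial; factors are in $\mathbb{Q}[t]$. For a prime $\ell$ and $1\le k\le n-1$, write $n=\sum_i n_i\ell^i$, $k=\sum_i k_i\ell^i$ with $0\le n_i,k_i<\ell$; $k$ is essential for $n$ in base $\ell$ if $k_i\le n_i$ for all $i$, and non-essential otherwise. *)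

(* Defs.v *)
From HB Require Import structures.
From mathcomp Require Import all_boot all_order all_fingroup all_algebra all_field.

Set Implicit Arguments.
Unset Strict Implicit.
Unset Printing Implicit Defensive.

Import GRing.Theory.

Local Open Scope ring_scope.

(* A permutation of [n] is s : 'S_n acting on {0, ..., n-1}, so that
   pi_i = s (i - 1) + 1 for 1 <= i <= n.  A position i of [n-1] is represented
   by the ordinal of value i in 'I_n (hence the condition 0 < i); then
   ord_pred i has value i - 1, and pi_i > pi_(i+1) reads s i < s (ord_pred i). *)
Definition positions (n : nat) : {set 'I_n} := [set i : 'I_n | (0 < i)%N].

Definition descent_set (n : nat) (s : 'S_n) : {set 'I_n} :=
  [set i in positions n | (s i < s (ord_pred i))%N].

Definition descent_beta (n : nat) (S : {set 'I_n}) : nat :=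
  #|[set s : 'S_n | descent_set s == S]|.

Definition descent_poly (n : nat) : {poly rat} :=
  \sum_(S : {set 'I_n} | S \subset positions n) 'X^(descent_beta S).

Definition digit (l n i : nat) : nat := ((n %/ l ^ i) %% l)%N.

Definition essential (l n k : nat) : Prop :=
  (0 < k < n)%N /\ forall i : nat, (digit l k i <= digit l n i)%N.

Definition nonessential (l n k : nat) : Prop :=
  (0 < k < n)%N /\ ~ essential l n k.

(* Main.v *)
Require Import Defs.
From HB Require Import structures.
From mathcomp Require Import all_boot all_order all_fingroup all_algebra all_field.
From mathcomp Require Import zify.

(** Let [beta S] be the number of permutations with descent set [S].  For a
    position [k], [beta S + beta (S + {k})] (symmetric difference) is
    ['C(n, k)] times the number of permutations that preserve the initial
    segment of length [k] and have the descents prescribed by [S] elsewhere.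
    So adding or removing a [k] with [p %| 'C(n, k)] negates [beta] modulo [p];
    here this holds for [3] and the three powers of two, as [n = 1 %[mod p]].

    Modulo 2, adding or removing [3] does not change [beta], while adding or
    removing [2 ^ x] changes it by [1] plus the number of elements of [S] of the
    form [2 ^ x + 2 ^ y], [y <> x].  Each of the three sums of two powers is
    counted for exactly two [x], so that number is even for some [x].  The
    involution replacing [S] by [S + {2 ^ x, 3}] for such an [x] fixes [beta]
    modulo [p] and flips its parity, and ['Phi_(2 * p)] divides
    ['X^e + 'X^f] when [e = f %[mod p]] and [e], [f] have different parities. *)

Set Implicit Arguments.
Unset Strict Implicit.
Unset Printing Implicit Defensive.

Import GRing.Theory.

(** * Reordering values by a subset and its complement *)

Lemma card_ord_below n k : k <= n -> #|[set i : 'I_n | i < k]| = k.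
Proof.
move=> kn; rewrite -[RHS]card_ord.
have inj : injective (widen_ord kn).
  by move=> i j e; apply: val_inj; exact: (congr1 val e).
rewrite -[RHS](card_imset _ inj).
apply: eq_card => i; rewrite inE; apply/idP/imsetP => [ik|[j _ ->]] /=.
  by exists (Ordinal ik) => //; apply: val_inj.
exact: ltn_ord.
Qed.

(* [x |-> split_rank A x] lists [A] increasingly, then its complement
   increasingly. *)
Definition split_rank (n : nat) (A : {set 'I_n}) (x : 'I_n) : nat :=
  (if x \in A then #|[set y in A | (y < x)]|
   else #|A| + #|[set y in ~: A | (y < x)]|).

Lemma card_below_mono (n : nat) (A : {set 'I_n}) (x y : 'I_n) :
  x \in A -> (x < y) ->
  (#|[set z in A | (z < x)]| < #|[set z in A | (z < y)]|).
Proof.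
move=> xA xy; apply: proper_card; apply/properP; split.
  by apply/subsetP => z; rewrite !inE => /andP[-> /ltn_trans ->].
by exists x; rewrite !inE xA ?ltnn.
Qed.

Lemma card_below_lt (n : nat) (A : {set 'I_n}) (x : 'I_n) :
  x \in A -> (#|[set z in A | (z < x)]| < #|A|).
Proof.
move=> xA; apply: proper_card; apply/properP; split.
  by apply/subsetP => z; rewrite !inE => /andP[->].
by exists x; rewrite // !inE xA ltnn.
Qed.

Lemma split_rank_ltA n (A : {set 'I_n}) x : (split_rank A x < #|A|) = (x \in A).
Proof.
by rewrite /split_rank; case: ifP => xA; [rewrite card_below_lt | lia].
Qed.

Lemma split_rank_ltn n (A : {set 'I_n}) x : (split_rank A x < n).
Proof.
have cA : (#|A| + #|~: A| = n) by rewrite cardsC card_ord.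
rewrite /split_rank; case: ifP => xA; first by have := card_below_lt xA; lia.
have xA' : x \in ~: A by rewrite inE xA.
by have := card_below_lt xA'; lia.
Qed.

Lemma split_rank_mono n (A : {set 'I_n}) x y :
  (x \in A) = (y \in A) -> (split_rank A x < split_rank A y) = (x < y).
Proof.
have lt z t : (z \in A) = (t \in A) -> (z < t) ->
    (split_rank A z < split_rank A t).
  rewrite /split_rank => <- zt; case: ifP => zA; first exact: card_below_mono.
  by rewrite ltn_add2l card_below_mono // inE zA.
move=> xy; case: (ltngtP x y) => [/lt->//|/lt|/val_inj->].
- by rewrite xy => /(_ erefl); lia.
- by rewrite ltnn.
Qed.

Definition split_rank_ord n (A : {set 'I_n}) x := Ordinal (split_rank_ltn A x).

Lemma split_rank_inj n (A : {set 'I_n}) : injective (split_rank_ord A).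
Proof.
move=> x y /(congr1 val) /= e.
have xyA : (x \in A) = (y \in A) by rewrite -!split_rank_ltA e.
have := split_rank_mono xyA; have := split_rank_mono (esym xyA).
by rewrite e ltnn => h1 h2; apply/val_inj => /=; lia.
Qed.

Definition split_perm n (A : {set 'I_n}) : 'S_n := perm (@split_rank_inj n A).

Lemma split_rank_ltl n (A : {set 'I_n}) k x :
  (forall y : 'I_n, (y < k) -> y \in A) -> (split_rank A x < k) = (x < k).
Proof.
move=> kA; case: (leqP n k) => nk.
  by rewrite !(leq_trans _ nk) ?split_rank_ltn.
have kcard : #|[set z : 'I_n | (z < k)]| = k by rewrite card_ord_below 1?ltnW.
case: (ltnP x k) => xk.
  rewrite /split_rank kA //; apply: (leq_ltn_trans _ xk).
  rewrite -[leqRHS](@card_ord_below n x) ?(ltnW (ltn_ord x)) //.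
  by apply: subset_leq_card; apply/subsetP => z; rewrite !inE => /andP[].
rewrite /split_rank; apply/negbTE; rewrite -leqNgt -{1}kcard.
case: ifP => xA; last apply: leq_trans (leq_addr _ _); apply: subset_leq_card;
  apply/subsetP => z; rewrite !inE => zk; rewrite kA //=.
exact: leq_trans xk.
Qed.

(** Outside [A], the rank of [x] is the size of the union of [A] with the elements below [x]. For
    [x < k] this union is properly contained in the initial segment of length [k]; for [k <= x] it
    contains that segment. *)
Lemma split_rank_ltr n (A : {set 'I_n}) k x : (k <= n) ->
  (forall y : 'I_n, y \in A -> (y < k)) -> (split_rank A x < k) = (x < k).
Proof.
move=> kn Ak.
have UE : x \notin A -> (#|A| + #|[set y in ~: A | (y < x)]|) =
    #|A :|: [set y : 'I_n | y < x]|.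
  move=> xA; have -> : A :|: [set y : 'I_n | y < x] =
      A :|: [set y in ~: A | (y < x)].
    by apply/setP => z; rewrite !inE; case: (z \in A).
  rewrite cardsU (_ : A :&: _ = set0) ?cards0 ?subn0 //.
  by apply/setP => z; rewrite !inE; case: (z \in A); rewrite ?andbF.
case: (ltnP x k) => xk; rewrite /split_rank; case: ifP => xA.
- apply: (leq_ltn_trans _ xk).
  rewrite -[leqRHS](@card_ord_below n x) ?(ltnW (ltn_ord x)) //.
  by apply: subset_leq_card; apply/subsetP => z; rewrite !inE => /andP[].
- rewrite UE ?xA // -[X in (_ < X)](card_ord_below kn).
  apply: proper_card; apply/properP; split; last by exists x; rewrite ?inE ?xA ?ltnn.
  by apply/subsetP => z; rewrite !inE => /orP[/Ak//|/ltn_trans->].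
- by have := Ak _ xA; lia.
- apply/negbTE; rewrite -leqNgt UE ?xA // (leq_trans xk) //.
  rewrite -[leqLHS](@card_ord_below n x) ?(ltnW (ltn_ord x)) //.
  by apply: subset_leq_card; apply/subsetP => z; rewrite !inE => ->; rewrite orbT.
Qed.

(** * Permutations preserving initial segments *)

Definition preserves n (s : 'S_n) (k : nat) : bool :=
  [forall i : 'I_n, (s i < k) == (i < k)].

Lemma preservesP n (s : 'S_n) k :
  reflect (forall i : 'I_n, (s i < k) = (i < k)) (preserves s k).
Proof. exact: 'forall_eqP. Qed.

(* Membership of [0] in [K] discards position [0], where [ord_pred] wraps
   around; [descent_beta] is the case [K = [:: 0; n]]. *)
Definition block_perms n (K : seq nat) (S : {set 'I_n}) : {set 'S_n} :=
  [set s : 'S_n | all (preserves s) K &&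
    [forall i : 'I_n, (val i \notin K) ==>
       ((s i < s (ord_pred i)) == (i \in S))]].

Lemma block_permsP n K (S : {set 'I_n}) (s : 'S_n) :
  reflect ((forall k, k \in K -> preserves s k) /\
    forall i : 'I_n, val i \notin K -> (s i < s (ord_pred i)) = (i \in S))
  (s \in block_perms K S).
Proof.
rewrite inE; apply: (iffP andP) => -[/allP sK sS]; split => //.
  by move=> i iK; move/forallP: sS => /(_ i); rewrite iK => /eqP.
by apply/forallP => i; apply/implyP => /sS->.
Qed.

Definition toggle n (S : {set 'I_n}) (j : 'I_n) : {set 'I_n} :=
  [set i | (i \in S) (+) (i == j)].

Lemma val_ord_pred n (i : 'I_n) : 0 < i -> val (ord_pred i) = i.-1.
Proof.
move=> i0 /=; have := ltn_ord i; case: (val i) i0 => // m _ mn.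
by rewrite addSn /= modnDr modn_small // ltnW.
Qed.

(* The union of the two sets is fibred over the image [A] of the initial segment
   of length [j]; multiplying by [split_perm A] identifies each fibre with
   [block_perms (j :: K) S]. *)
Lemma card_block_perms_toggle n K (S : {set 'I_n}) (j : 'I_n) lo hi :
  0 \in K -> lo \in K -> hi \in K -> lo < j < hi -> hi <= n ->
  {in K, forall k, (k <= lo) || (hi <= k)} ->
  #|block_perms K S| + #|block_perms K (toggle S j)| =
  'C(hi - lo, j - lo) * #|block_perms (val j :: K) S|.
Proof.
move=> K0 Klo Khi /andP[loj jhi] hin Kgap.
have jK : val j \notin K.
  by apply/negP => /Kgap /=; lia.
have jn := ltn_ord j.
(* [X] leaves the comparison at [j] free, so it is the disjoint union of the two sets counted on the
   left. *)
pose X := [set s : 'S_n | all (preserves s) K &&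
  [forall i : 'I_n, (val i \notin val j :: K) ==>
       ((s i < s (ord_pred i)) == (i \in S))]].
pose L := [set i : 'I_n | i < lo].
pose J := [set i : 'I_n | i < j].
pose M := [set i : 'I_n | lo <= i < hi].
have cardL : #|L| = lo by rewrite card_ord_below //; lia.
have cardJ : #|J| = j by rewrite card_ord_below //; lia.
have cardM : #|M| = hi - lo.
  have -> : M = [set i : 'I_n | i < hi] :\: L.
    by apply/setP => i; rewrite !inE -leqNgt andbC.
  rewrite cardsD card_ord_below // (setIidPr _) ?cardL //.
  by apply/subsetP => i; rewrite !inE; lia.
transitivity #|X|.
  rewrite -cardsUI (_ : block_perms K S :&: _ = set0) ?cards0 ?addn0.
    apply: eq_card => s; apply/setUP/idP.
      case=> /block_permsP[sK sS]; rewrite inE; apply/andP; split; try exact/allP;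
        apply/forallP => i; apply/implyP; rewrite inE negb_or => /andP[ij iK];
        rewrite sS // inE -[i == j]val_eqE (negbTE ij) ?addbF //.
    rewrite inE => /andP[/allP sK /forallP sX].
    have [e|e] := eqVneq (s j < s (ord_pred j)) (j \in S); [left|right];
      apply/block_permsP; split=> // i iK;
      (have [->|ij] := eqVneq i j; [|have := sX i; rewrite inE negb_or iK andbT
         -[_ == _]/(i == j) ij /= => /eqP->]) => //.
      by rewrite inE eqxx addbT; case: (_ < _) e; case: (_ \in _).
    by rewrite inE (negbTE ij) addbF.
  apply/setP => s; rewrite [RHS]inE; apply/negP => /setIP[].
  move=> /block_permsP[_ /(_ j jK) e1] /block_permsP[_ /(_ j jK)]; rewrite e1.
  by rewrite inE eqxx addbT; case: (_ \in _).
rewrite -cardM -cards_draws -sum1_card.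
(* As [s] preserves [L], the image of [J] consists of [L] and [j - lo] values in [M]; the choice of
   the latter accounts for the binomial coefficient. *)
rewrite (partition_big (fun s : 'S_n => (s @: J) :\: L)
   (mem [set A : {set 'I_n} | A \subset M & #|A| == j - lo])) /=; last first.
  move=> s; rewrite !inE => /andP[/allP sK _].
  have /preservesP slo := sK _ Klo; have /preservesP shi := sK _ Khi.
  apply/andP; split.
    apply/subsetP => x /setDP[/imsetP[i]]; rewrite !inE => ij ->.
    by rewrite -leqNgt => -> /=; rewrite shi; lia.
  rewrite cardsD card_imset ?cardJ; last exact: perm_inj.
  rewrite (setIidPr _) ?cardL //.
  apply/subsetP => x; rewrite inE => xlo; apply/imsetP.
  exists ((s^-1)%g x); last by rewrite permKV.
  by rewrite inE (ltn_trans _ loj) // -slo permKV.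
rewrite -sum_nat_const; apply: eq_bigr => B; rewrite inE => /andP[BM /eqP cB].
pose A := L :|: B.
have LB : [disjoint L & B].
  rewrite disjoint_sym disjoint_subset; apply/subsetP => x /(subsetP BM).
  rewrite !inE; lia.
have cA : #|A| = j by rewrite cardsU disjoint_setI0 // cards0 cardL cB; lia.
(* In a product [s * t] the factor [s] acts first, so this multiplication relabels values: those in
   [A] become the values below [j]. *)
rewrite sum1_card -[RHS](card_preimset _ (mulIg (split_perm A))).
have rkj x : (split_rank A x < j) = (x \in A) by rewrite -cA split_rank_ltA.
have rkK k x : k \in K -> (split_rank A x < k) = (x < k).
  move=> /Kgap /orP[klo|hik].
    by apply: split_rank_ltl => y yk; rewrite !inE (leq_trans yk klo).
  case: (leqP k n) => kn; last by rewrite !(ltn_trans _ kn) ?split_rank_ltn.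
  apply: split_rank_ltr => // y /setUP[|/(subsetP BM)]; rewrite !inE; lia.
have valE s i : val ((s * split_perm A)%g i) = split_rank A (s i).
  by rewrite permM permE.
have presE s k : k \in K -> preserves (s * split_perm A)%g k = preserves s k.
  by move=> kK; apply: eq_forallb => i; rewrite valE rkK.
(* Since [i] is not [j], the positions [i - 1] and [i] are on the same side of [j]. Their values
   under [s] are then both in [A] or both outside, where [split_rank] is increasing. *)
have desE s i : preserves (s * split_perm A)%g j -> val i \notin val j :: K ->
    ((s * split_perm A)%g i < (s * split_perm A)%g (ord_pred i)) =
    (s i < s (ord_pred i)).
  move=> /preservesP sj; rewrite inE negb_or => /andP[ij iK].
  have i0 : 0 < i by rewrite lt0n; apply: contraNneq iK => e; rewrite /= e.
  rewrite !valE split_rank_mono // -!rkj -!valE !sj val_ord_pred //.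
  by move: ij => /=; lia.
have imE s : preserves s lo ->
    (s @: J :\: L == B) = preserves (s * split_perm A)%g j.
  move=> /preservesP slo; apply/eqP/preservesP => [e i|sj].
    rewrite valE rkj inE -e inE !inE mem_imset; last exact: perm_inj.
    by rewrite inE slo; lia.
  apply/setP => x; rewrite -(permKV s x); set i := (s^-1)%g x.
  rewrite !inE mem_imset; last exact: perm_inj.
  rewrite inE -sj valE rkj in_setU [s i \in L]inE.
  case: (boolP (s i \in B)) => [/(subsetP BM)|_]; rewrite ?inE ?orbT ?orbF; lia.
apply: eq_card => s; rewrite [RHS]inE unfold_in; apply/andP/block_permsP.
  rewrite inE => -[/andP[/allP sK /forallP sX]]; rewrite imE; last exact: sK.
  move=> sj; split=> [k|i iK].
    by rewrite inE => /predU1P[->//|kK]; rewrite presE ?sK.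
  by rewrite desE //; move: (sX i); rewrite iK => /eqP.
case=> sK sX.
have sK' k : k \in K -> preserves s k.
  by move=> kK; rewrite -presE // sK // inE kK orbT.
have sj : preserves (s * split_perm A)%g j by rewrite sK // inE eqxx.
rewrite imE ?sK' // inE; split=> //; apply/andP; split; first exact/allP.
by apply/forallP => i; apply/implyP => iK; rewrite -desE // sX.
Qed.

(** * Binomial coefficients modulo a prime *)

(** Coefficient form of [(1 + X)^q = 1 + X^q] modulo [p]: in Vandermonde's convolution only the
    terms [0] and [q] survive. *)
Lemma bin_addn_mod p q m k : 0 < q -> (forall i, 0 < i < q -> p %| 'C(q, i)) ->
  'C(m + q, k) = 'C(m, k) + (q <= k) * 'C(m, k - q) %[mod p].
Proof.
move=> q0 pq; rewrite addnC -binomial.Vandermonde -modn_summ.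
have E (j : 'I_k.+1) : 'C(q, j) * 'C(m, k - j) %% p =
    ((j == 0 :> nat) + (j == q :> nat)) * 'C(m, k - j) %% p.
  rewrite -modnMml -[RHS]modnMml; congr ((_ * _) %% _).
  case: (ltngtP j q) => [jq|jq|->].
  - have [->|j0] := posnP j; first by rewrite bin0.
    by rewrite addn0 mod0n; apply/eqP; apply: pq; rewrite j0.
  - by rewrite bin_small // (gtn_eqF (ltn_trans q0 jq)).
  - by rewrite binn (gtn_eqF q0).
rewrite (eq_bigr _ (fun j _ => E j)) modn_summ; congr (_ %% _).
under eq_bigr do rewrite mulnDl.
rewrite big_split /= big_ord_recl /= subn0 mul1n big1 ?addn0 //; congr (_ + _).
case: (leqP q k) => qk.
  rewrite (bigD1 (Ordinal (qk : q < k.+1))) //= eqxx big1 ?addn0 // => j.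
  by rewrite -val_eqE /= => /negbTE->.
by rewrite big1 // => j _; rewrite (ltn_eqF (leq_ltn_trans (leq_ord j) qk)).
Qed.

(** The lowest-digit case of Lucas's theorem. Removing [p] from the upper argument keeps all
    residues, so induction on the quotient leads to an upper argument below [k]. *)
Lemma dvdn_bin_mod p n k : prime p -> n %% p < k %% p -> p %| 'C(n, k).
Proof.
move=> pp; rewrite {2}(divn_eq n p) addnC.
elim: (n %/ p) k => [|m IH] k nk.
  by rewrite mul0n addn0 bin_small ?dvdn0 // (leq_trans nk) // leq_mod.
rewrite mulSn (addnC p) addnA /dvdn bin_addn_mod ?prime_gt0 //; last first.
  by move=> i; apply: prime_dvd_bin.
apply: dvdn_add; first exact: IH.
case: (leqP p k) => pk //; rewrite mul1n IH //.
by rewrite -(subnK pk) modnDr in nk.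
Qed.

Lemma dvdn_bin_pow2 x i : 0 < i < 2 ^ x -> 2 %| 'C(2 ^ x, i).
Proof.
elim: x i => [|x IH] i; first by rewrite expn0; lia.
have x0 : 0 < 2 ^ x by rewrite expn_gt0.
rewrite expnS mul2n -addnn => /andP[i0 ix]; rewrite /dvdn bin_addn_mod //.
case: (ltngtP i (2 ^ x)) => [ix'|ix'|->].
- by rewrite addn0; apply: IH; rewrite i0.
- rewrite bin_small // mul1n; apply: IH; lia.
- by rewrite subnn binn bin0.
Qed.

Lemma odd_bin_addn_pow2 m x k :
  odd 'C(m + 2 ^ x, k) = odd 'C(m, k) (+) (2 ^ x <= k) && odd 'C(m, k - 2 ^ x).
Proof.
have /(congr1 odd) := @bin_addn_mod 2 (2 ^ x) m k (expn_gt0 2 x) (@dvdn_bin_pow2 x).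
by rewrite !modn2 !oddb oddD oddM oddb.
Qed.

Lemma odd_bin_pow2 x k : odd 'C(2 ^ x, k) = (k == 0) || (k == 2 ^ x).
Proof.
case: (ltngtP k (2 ^ x)) => [kx|kx|->]; last by rewrite binn orbT.
- have [->|k0] := posnP k; first by rewrite bin0.
  by rewrite orbF -[LHS]negbK -dvdn2 dvdn_bin_pow2 ?k0 // (gtn_eqF k0).
- by rewrite bin_small // orbF gtn_eqF // (ltn_trans _ kx) // expn_gt0.
Qed.

(** For [x < y] the sum lies strictly between the consecutive powers [2 ^ y] and [2 ^ y.+1]. *)
Lemma pow2_neqD x y z : x != y -> 2 ^ z != 2 ^ x + 2 ^ y.
Proof.
wlog xy : x y / x < y => [wl|] xy'.
  case: (ltngtP x y) => h; [exact: wl|by rewrite addnC wl // eq_sym|lia].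
have := ltn_exp2l x y (isT : 1 < 2); rewrite xy => h.
have x0 : 0 < 2 ^ x by rewrite expn_gt0.
case: (leqP z y) => zy.
  by have := leq_exp2l z y (isT : 1 < 2); rewrite zy; lia.
by have := leq_exp2l y.+1 z (isT : 1 < 2); rewrite zy expnS; lia.
Qed.

Lemma odd_bin_pow2D y z k : y != z -> 0 < k < 2 ^ y + 2 ^ z ->
  odd 'C(2 ^ y + 2 ^ z, k) = (k == 2 ^ y) || (k == 2 ^ z).
Proof.
move=> yz /andP[k0 kn]; have yz' : 2 ^ y != 2 ^ z by rewrite eqn_exp2l.
rewrite odd_bin_addn_pow2 !odd_bin_pow2; lia.
Qed.

Lemma odd_bin_pow2D3 x y z : x != y -> x != z -> y != z ->
  odd 'C(2 ^ x + 2 ^ y + 2 ^ z, 2 ^ x).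
Proof.
move=> xy xz yz; rewrite -addnA addnC odd_bin_addn_pow2 leqnn subnn bin0.
have := pow2_neqD x yz.
have : 2 ^ x != 2 ^ y by rewrite eqn_exp2l.
have : 2 ^ x != 2 ^ z by rewrite eqn_exp2l.
have x0 : 0 < 2 ^ x by rewrite expn_gt0.
rewrite odd_bin_addn_pow2 !odd_bin_pow2; lia.
Qed.

(** * Parity of the block counts *)

(** Toggling elements one at a time leads from any set to the empty one. Parity formulas thus need a
    check only at [set0], where the identity is the single permutation counted. *)
Lemma toggle_inv n (f : {set 'I_n} -> bool) S :
  (forall S j, f (toggle S j) = f S) -> f S = f set0.
Proof.
move=> fj; have [m] := ubnP #|S|; elim: m S => // m IH S Sm.
have [->//|[j jS]] := set_0Vmem S.
have e : toggle S j = S :\ j.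
  by apply/setP => i; rewrite !inE; case: eqP => [->|_]; rewrite ?jS ?addbF.
rewrite -(fj S j) IH // e; have := cardsD1 j S; rewrite jS; lia.
Qed.

Lemma toggle_memE n (S : {set 'I_n}) i j :
  (i \in toggle S j) = (i \in S) (+) (i == j).
Proof. by rewrite inE. Qed.

(** Induction on positions gives [i <= s i]; both sides have the same sum over all [i], so equality
    holds throughout. *)
Lemma increasing_perm1 n (s : 'S_n) :
  (forall i : 'I_n, 0 < i -> s (ord_pred i) < s i) -> s = 1%g.
Proof.
move=> inc; have les (i : 'I_n) : i <= s i.
  move: {2}(val i) (erefl (val i)) => m; elim: m i => [|m IH] i im.
    by rewrite [nat_of_ord i]im.
  have i0 : 0 < i by rewrite [nat_of_ord i]im.
  have /IH : val (ord_pred i) = m by rewrite val_ord_pred // im.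
  rewrite val_ord_pred // => h; have := inc i i0; lia.
have [_] := leqif_sum (fun i (_ : xpredT i) => leqif_eq (les i)).
rewrite -(reindex_inj (@perm_inj _ s) (P := xpredT) (F := @nat_of_ord n)) eqxx.
move=> /esym/forallP h; apply/permP => i; rewrite perm1.
by apply/val_inj/esym/eqP; have := h i; rewrite /=.
Qed.

Lemma block_perms_set0 n K : 0 \in K -> block_perms K (set0 : {set 'I_n}) = [set 1%g].
Proof.
move=> K0; apply/setP => s; rewrite in_set1; apply/block_permsP/eqP => [[sK sS]|->].
  apply: increasing_perm1 => i i0; case: (boolP (val i \in K)) => iK.
    have /preservesP sp := sK _ iK.
    have := sp i; have := sp (ord_pred i); rewrite val_ord_pred //=; lia.
  have := sS i iK; rewrite inE => /negbT; rewrite -leqNgt leq_eqVlt => /orP[|//].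
  move=> /eqP/val_inj/perm_inj/(congr1 val); rewrite val_ord_pred //=; lia.
split=> [k _|i iK]; first by apply/preservesP => i; rewrite perm1.
have i0 : 0 < i by rewrite lt0n; apply: contraNneq iK => e; rewrite /= e.
by rewrite !perm1 val_ord_pred // inE; lia.
Qed.

Lemma block_perms_toggle_in n K (S : {set 'I_n}) (j : 'I_n) :
  val j \in K -> block_perms K (toggle S j) = block_perms K S.
Proof.
move=> jK; apply/setP => s; rewrite !inE; congr (_ && _); apply: eq_forallb => i.
case: (boolP (val i \in K)) => //= iK; rewrite inE.
by have [e|_] := eqVneq i j; [rewrite e jK in iK | rewrite addbF].
Qed.

Lemma odd_block_perms_toggle n K (S : {set 'I_n}) (j : 'I_n) lo hi :
  0 \in K -> lo \in K -> hi \in K -> lo < j < hi -> hi <= n ->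
  {in K, forall k, (k <= lo) || (hi <= k)} ->
  odd #|block_perms K (toggle S j)| = odd #|block_perms K S| (+)
    (odd 'C(hi - lo, j - lo) && odd #|block_perms (val j :: K) S|).
Proof.
move=> K0 Kl Kh jlh hn gap.
have := congr1 odd (card_block_perms_toggle S K0 Kl Kh jlh hn gap).
by rewrite oddD oddM => <-; rewrite addKb.
Qed.

(** The blocks have lengths [2 ^ x], [2 ^ y], [2 ^ z]. A toggle inside a block changes the count by
    an even binomial multiple modulo 2, so the parity is that at [set0]. *)
Lemma odd_block_perms3 n x y z (S : {set 'I_n}) : n = 2 ^ x + 2 ^ y + 2 ^ z ->
  odd #|block_perms [:: 2 ^ x + 2 ^ y; 2 ^ x; 0; n] S|.
Proof.
move=> hn; set K := [:: _; _; _; _].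
have K0 : 0 \in K by rewrite !inE eqxx !orbT.
rewrite (toggle_inv (f := fun S => odd #|block_perms K S|)) => [|{}S j].
  by rewrite block_perms_set0 // cards1.
have [jK|jK] := boolP (val j \in K); first by rewrite block_perms_toggle_in.
move: (jK); rewrite !inE /= !negb_or => /and4P[j1 j2 j3 _].
have jn := ltn_ord j.
have step lo e : lo \in K -> lo + 2 ^ e \in K -> lo < j < lo + 2 ^ e ->
    lo + 2 ^ e <= n -> {in K, forall k, (k <= lo) || (lo + 2 ^ e <= k)} ->
    odd #|block_perms K (toggle S j)| = odd #|block_perms K S|.
  move=> Kl Kh jlh hi gap; rewrite (odd_block_perms_toggle S K0 Kl Kh) //.
  by rewrite addKn odd_bin_pow2 (_ : _ || _ = false) ?addbF //; lia.
case: (ltnP j (2 ^ x)) => jx.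
  apply: (step 0 x); rewrite ?inE ?add0n ?eqxx ?orbT //; [lia|lia|].
  by move=> k; rewrite !inE => /or4P[] /eqP->; lia.
case: (ltnP j (2 ^ x + 2 ^ y)) => jy.
  apply: (step (2 ^ x) y); rewrite ?inE ?eqxx ?orbT //; [lia|lia|].
  by move=> k; rewrite !inE => /or4P[] /eqP->; lia.
apply: (step (2 ^ x + 2 ^ y) z); rewrite ?inE -?hn ?eqxx ?orbT //; [lia|].
by move=> k; rewrite !inE => /or4P[] /eqP->; lia.
Qed.

(** Inside the block of length [2 ^ y + 2 ^ z] the binomial coefficient is odd only at offsets
    [2 ^ y] and [2 ^ z], that is at [wy] and [wz]. There the refined count is odd by
    [odd_block_perms3], so the parity changes together with the membership. *)
Lemma odd_block_perms2 n x y z (S : {set 'I_n}) (wy wz : 'I_n) :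
  n = 2 ^ x + 2 ^ y + 2 ^ z -> y != z ->
  wy = 2 ^ x + 2 ^ y :> nat -> wz = 2 ^ x + 2 ^ z :> nat ->
  odd #|block_perms [:: 2 ^ x; 0; n] S| = ~~ ((wy \in S) (+) (wz \in S)).
Proof.
move=> hn yz hy hz; set K := [:: _; _; _].
have K0 : 0 \in K by rewrite !inE eqxx !orbT.
have yz' : 2 ^ y != 2 ^ z by rewrite eqn_exp2l.
suff : odd #|block_perms K S| (+) (wy \in S) (+) (wz \in S).
  by case: (odd _); case: (wy \in S); case: (wz \in S).
rewrite (toggle_inv (f := fun S => odd #|block_perms K S| (+) (wy \in S)
   (+) (wz \in S))) => [|{}S j].
  by rewrite block_perms_set0 // cards1 !inE.
have hn' : n = 2 ^ x + 2 ^ z + 2 ^ y by rewrite addnAC.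
have jn := ltn_ord j; have x0 : 0 < 2 ^ x by rewrite expn_gt0.
have y0 : 0 < 2 ^ y by rewrite expn_gt0.
have z0 : 0 < 2 ^ z by rewrite expn_gt0.
rewrite !toggle_memE -!val_eqE /= hy hz.
have [jK|jK] := boolP (val j \in K).
  have : j <= 2 ^ x by move: jK; rewrite !inE /=; lia.
  rewrite block_perms_toggle_in // => jx.
  have -> : (2 ^ x + 2 ^ y == j) = false by lia.
  have -> : (2 ^ x + 2 ^ z == j) = false by lia.
  by rewrite !addbF.
move: (jK); rewrite !inE /= !negb_or => /and3P[j1 j2 _].
case: (ltnP j (2 ^ x)) => jx.
  rewrite (odd_block_perms_toggle S (lo := 0) (hi := 2 ^ x)) ?inE ?eqxx ?orbT //.
  - rewrite !subn0 odd_bin_pow2 (negbTE j1) (negbTE j2).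
    have -> : (2 ^ x + 2 ^ y == j) = false by lia.
    have -> : (2 ^ x + 2 ^ z == j) = false by lia.
    by rewrite !addbF.
  - lia.
  - lia.
  - by move=> k; rewrite !inE => /or3P[] /eqP->; lia.
rewrite (odd_block_perms_toggle S (lo := 2 ^ x) (hi := n)) ?inE ?eqxx ?orbT //.
- have -> : n - 2 ^ x = 2 ^ y + 2 ^ z by lia.
  rewrite odd_bin_pow2D //; last by lia.
  have [e|ne] := eqVneq (j - 2 ^ x) (2 ^ y).
    have ej : j = 2 ^ x + 2 ^ y :> nat by lia.
    rewrite /= ej (odd_block_perms3 _ hn) eqxx eqn_add2l eq_sym (negbTE yz').
    by case: (odd _); case: (wy \in S); case: (wz \in S).
  have [e|ne'] := eqVneq (j - 2 ^ x) (2 ^ z).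
    have ej : j = 2 ^ x + 2 ^ z :> nat by lia.
    rewrite /= ej (odd_block_perms3 _ hn') eqxx eqn_add2l (negbTE yz').
    by case: (odd _); case: (wy \in S); case: (wz \in S).
  rewrite !addbF; have -> : (2 ^ x + 2 ^ y == j) = false by lia.
  have -> : (2 ^ x + 2 ^ z == j) = false by lia.
  by rewrite !addbF.
- lia.
- by move=> k; rewrite !inE => /or3P[] /eqP->; lia.
Qed.

Lemma odd_block_perms1_toggle n x y z (S : {set 'I_n}) (v wy wz : 'I_n) :
  n = 2 ^ x + 2 ^ y + 2 ^ z -> x != y -> x != z -> y != z ->
  v = 2 ^ x :> nat -> wy = 2 ^ x + 2 ^ y :> nat -> wz = 2 ^ x + 2 ^ z :> nat ->
  odd #|block_perms [:: 0; n] (toggle S v)| =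
  odd #|block_perms [:: 0; n] S| (+) ~~ ((wy \in S) (+) (wz \in S)).
Proof.
move=> hn xy xz yz hv hy hz; have v0 : 0 < v by rewrite hv expn_gt0.
rewrite (odd_block_perms_toggle S (lo := 0) (hi := n)) ?inE ?eqxx ?orbT //.
- rewrite /= !subn0 hv (odd_block_perms2 S hn yz hy hz).
  have -> : odd 'C(n, 2 ^ x) by rewrite hn odd_bin_pow2D3.
  by [].
- by rewrite v0 ltn_ord.
- by move=> k; rewrite !inE => /orP[] /eqP->; rewrite ?leqnn ?orbT.
Qed.

(** * Toggles modulo [p] and descent numbers *)

Lemma dvdn_block_perms1_toggle n p (S : {set 'I_n}) (j : 'I_n) :
  0 < j -> p %| 'C(n, j) ->
  p %| #|block_perms [:: 0; n] S| + #|block_perms [:: 0; n] (toggle S j)|.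
Proof.
move=> j0 pC; rewrite (card_block_perms_toggle S (lo := 0) (hi := n)) ?inE ?eqxx ?orbT //.
- by rewrite !subn0 dvdn_mulr.
- by rewrite j0 ltn_ord.
- by move=> k; rewrite !inE => /orP[] /eqP->; rewrite ?leqnn ?orbT.
Qed.

Lemma descent_betaE n (S : {set 'I_n}) : S \subset positions n ->
  descent_beta S = #|block_perms [:: 0; n] S|.
Proof.
move=> /subsetP S0; apply: eq_card => s; rewrite [LHS]inE.
apply/eqP/block_permsP => [<-|[_ sS]].
  split=> [k|i].
    rewrite !inE => /orP[] /eqP->; apply/preservesP => i //.
    by rewrite !ltn_ord.
  by rewrite !inE negb_or -lt0n => /andP[->].
apply/setP => i; rewrite !inE; case: (posnP i) => [i0|i0] /=.
  by symmetry; apply/negP => /S0; rewrite inE i0.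
apply: sS; rewrite !inE negb_or -lt0n i0 /= ltn_eqF //; exact: ltn_ord.
Qed.

(** * Cyclotomic divisors of binomials, and sums over an involution *)

Section Polynomials.

Local Open Scope ring_scope.

(** Among the cyclotomic factors of [X^(2p) - 1], those indexed by divisors of [p] multiply to
    [X^p - 1]. Cancelling them leaves [X^p + 1], and the index [2 * p] is among the remaining
    ones. *)
Lemma Cyclotomic_double_dvd p : prime p -> odd p ->
  map_poly intr 'Phi_(2 * p) %| ('X^p + 1 : {poly rat}).
Proof.
move=> pp po; have p0 := prime_gt0 pp.
have p20 : (0 < 2 * p)%N by rewrite muln_gt0.
have Xp0 : 'X^p - 1 != 0 :> {poly int} by rewrite monic_neq0 // monicXnsubC.
suff [q e] : exists q : {poly int}, 'X^p + 1 = q * 'Phi_(2 * p).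
  apply/dvdpP; exists (map_poly intr q).
  by rewrite -rmorphM -e rmorphD /= map_polyXn rmorph1.
have : (2 * p)%N \in [seq d <- divisors (2 * p) | ~~ (d %| p)%N].
  by rewrite mem_filter -dvdn_divisors // dvdnn andbT gtnNdvd //; lia.
move=> /perm_to_rem /(perm_big _) H.
have := prod_Cyclotomic p20.
rewrite (bigID (fun d => d %| p)%N) /= -big_filter.
rewrite (perm_big (divisors p)) /=; last first.
  apply: uniq_perm; rewrite ?filter_uniq ?divisors_uniq // => d.
  rewrite mem_filter -!dvdn_divisors //.
  by apply/andP/idP => [[]//|dp]; rewrite dp dvdn_mull.
rewrite prod_Cyclotomic // -[X in _ * X]big_filter H big_cons.
rewrite mulnC exprM -[X in _ = _ ^+ 2 - X](expr1n _ 2) subr_sqr.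
move=> /(mulfI Xp0) <-; eexists; exact: mulrC.
Qed.

(** The difference of the exponents is an odd multiple [m * p], and [X^p + 1] divides [X^(mp) + 1]
    for odd [m]. *)
Lemma Cyclotomic_double_dvdD p e f : prime p -> odd p ->
  (e = f %[mod p])%N -> odd e != odd f ->
  map_poly intr 'Phi_(2 * p) %| ('X^e + 'X^f : {poly rat}).
Proof.
move=> pp po; wlog fe : e f / (f <= e)%N => [wl|] ef oef.
  case: (leqP f e) => h; first exact: wl.
  by rewrite addrC wl // 1?ltnW // eq_sym.
have /dvdnP[m em] : (p %| e - f)%N by rewrite -eqn_mod_dvd //; apply/eqP.
have om : odd m.
  have := congr1 odd em; rewrite oddB // oddM po andbT => <-.
  by move: oef; do 2! case: (odd _).
have -> : e = (m * p + f)%N by rewrite -em subnK.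
rewrite exprD -[X in _ + X]mul1r -mulrDl dvdp_mulr // (mulnC m) exprM.
apply: dvdp_trans (Cyclotomic_double_dvd pp po) _.
have -> : 'X^p ^+ m + 1 = 'X^p ^+ m - (-1) ^+ m :> {poly rat}.
  by rewrite -signr_odd om expr1 opprK.
by rewrite subrXX opprK dvdp_mulr.
Qed.

Lemma dvdp_sum_involution (T : finType) (P : pred T) (phi : T -> T)
    (f : T -> {poly rat}) (d : {poly rat}) :
  involutive phi -> (forall S, P (phi S) = P S) ->
  (forall S, P S -> d %| f S + f (phi S)) -> d %| \sum_(S | P S) f S.
Proof.
move=> phiK Pphi dP; set Q := \sum_(S | P S) f S.
have e : Q + Q = \sum_(S | P S) (f S + f (phi S)).
  rewrite big_split; congr (_ + _); rewrite [LHS](reindex_inj (inv_inj phiK)).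
  exact: eq_bigl.
(* Pairing counts every term twice, which is harmless since [2] is a unit in [rat]. *)
rewrite -(@dvdpZr _ 2%:R) // scaler_nat mulr2n e.
by apply: (big_ind (fun q => d %| q)) => [|q r|S /dP] //; exact: dvdp_add.
Qed.

End Polynomials.

(** * Powers of two modulo [p], and bookkeeping for toggles *)

Lemma expn2_eq_mod_order p (u : {unit 'Z_p}) m k : 1 < p -> val u = 2%:R%R ->
  (2 ^ m == 2 ^ k %[mod p]) = (m == k %[mod #[u]%g]).
Proof.
move=> p1 hu; rewrite -cyclic.eq_expg_mod_order.
have E i : nat_of_ord (val (u ^+ i)%g) = 2 ^ i %% p.
  by rewrite FinRing.val_unitX hu -natrX val_Zp_nat.
by rewrite -!E -[RHS](inj_eq val_inj) -[RHS](inj_eq val_inj).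
Qed.

Lemma nonessential_digit0 l n k : 0 < k < n -> n %% l < k %% l -> nonessential l n k.
Proof.
move=> kn lt; split=> // -[_ /(_ 0)].
by rewrite /digit expn0 !divn1 leqNgt lt.
Qed.

Lemma toggleK n (S : {set 'I_n}) j : toggle (toggle S j) j = S.
Proof. by apply/setP => i; rewrite !inE addbK. Qed.

Lemma toggleC n (S : {set 'I_n}) i j : toggle (toggle S i) j = toggle (toggle S j) i.
Proof. by apply/setP => k; rewrite !inE addbAC. Qed.

Lemma toggle_positions n (S : {set 'I_n}) (j : 'I_n) : 0 < j ->
  (toggle S j \subset positions n) = (S \subset positions n).
Proof.
move=> j0; apply/subsetP/subsetP => h i; have := h i; rewrite !inE;
  by have [->|_] := eqVneq i j; rewrite ?addbF.
Qed.

(** Applied with [r] equal to [2] or [1]: exponents congruent to [g - 2] give inverses of [4], those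
    congruent to [g - 1] inverses of [2]. *)
Lemma expn2_mod_order p (u : {unit 'Z_p}) x r : 1 < p -> val u = 2%:R%R ->
  r <= #[u]%g -> x %% #[u]%g = #[u]%g - r -> 2 ^ r * 2 ^ x = 1 %[mod p].
Proof.
move=> p1 hu rg xr; apply/eqP.
rewrite -expnD -[1]/(2 ^ 0) (expn2_eq_mod_order _ _ p1 hu).
by rewrite -modnDmr xr subnKC // modnn mod0n.
Qed.

Lemma order2_gt2 p (u : {unit 'Z_p}) : 5 <= p -> val u = 2%:R%R -> 2 < #[u]%g.
Proof.
move=> p5 hu; have p1 : 1 < p by apply: leq_trans p5.
have E m k := expn2_eq_mod_order m k p1 hu.
have := E 1 0; have := E 2 0; rewrite !(@modn_small (2 ^ _) p) //; try lia.
by case: #[u]%g (order_gt0 u) => [|[|[|]]].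
Qed.

(** Residue [0] would give [0 = 1] modulo [p], and residue [1] would give [2 ^ r = 1], although
    [2 ^ r] is [2] or [4], below [p]. *)
Lemma modn_expn2_gt1 p r x : 5 <= p -> 0 < r <= 2 ->
  2 ^ r * 2 ^ x = 1 %[mod p] -> 1 < 2 ^ x %% p.
Proof.
move=> p5 r12; rewrite -modnMmr (@modn_small 1 p); last by lia.
have [r2 r5] : 1 < 2 ^ r /\ 2 ^ r < 5 by case: r r12 => [|[|[|]]].
case: (2 ^ x %% p) => [|[|//]]; first by rewrite muln0 mod0n.
by rewrite muln1 modn_small; lia.
Qed.

(** Multiplied by [4], the sum becomes [1 + 1 + 2 = 4] modulo [p], and [4] is coprime to [p]. *)
Lemma modn_eq1_of_residues p A B C : odd p -> 1 < p ->
  4 * A = 1 %[mod p] -> 4 * B = 1 %[mod p] -> 2 * C = 1 %[mod p] ->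
  (A + B + C) %% p = 1.
Proof.
move=> po p1 hA hB hC; rewrite -[RHS](modn_small p1); apply/eqP.
have c4 : coprime p 4 by rewrite (@coprimeXr 2 p 2) // coprimen2.
have h : 4 * (A + B + C) = 4 * 1 %[mod p].
  have -> : 4 * (A + B + C) = 4 * A + 4 * B + 2 * (2 * C) by lia.
  rewrite -modnDm -(modnDm (4 * A)) hA hB -(modnMmr 2) hC.
  by rewrite (modn_small p1) modnDm.
(* [eqn_mod_dvd] rests on truncated subtraction, so [1 <= A + B + C] is required. *)
have ABC : 0 < A + B + C.
  by case: A B C hA hB hC h => [|A]; rewrite ?muln0 ?mod0n ?(modn_small p1).
by rewrite eqn_mod_dvd // -(Gauss_dvdr _ c4) mulnBr -eqn_mod_dvd ?leq_mul //; apply/eqP.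
Qed.

Lemma perm_eq_two_one (T : eqType) (x y z r s : T) : perm_eq [:: x; y; z] [:: r; r; s] ->
  [\/ [/\ x = r, y = r & z = s], [/\ x = r, z = r & y = s] | [/\ y = r, z = r & x = s]].
Proof.
move=> h.
have : s \in [:: x; y; z] by rewrite (perm_mem h) !inE eqxx !orbT.
have two (v w : T) : perm_eq [:: v; w] [:: r; r] -> v = r /\ w = r.
  move=> vw; split; apply/eqP; have := perm_mem vw.
    by move/(_ v); rewrite !inE eqxx orbb.
  by move/(_ w); rewrite !inE eqxx orbT orbb.
have rot_s : perm_eq [:: r; r; s] [:: s; r; r] by rewrite (perm_catC [:: r; r] [:: s]).
rewrite !inE => /or3P[] /eqP e; subst s.
- by apply: Or33; move: (perm_trans h rot_s); rewrite perm_cons => /two[].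
- apply: Or32; have : perm_eq [:: y; x; z] [:: y; r; r].
    by apply: perm_trans (perm_trans h rot_s); rewrite (perm_catCA [:: y] [:: x] [:: z]).
  by rewrite perm_cons => /two[].
- apply: Or31; have : perm_eq [:: z; x; y] [:: z; r; r].
    by apply: perm_trans (perm_trans h rot_s); rewrite (perm_catC [:: z] [:: x; y]).
  by rewrite perm_cons => /two[].
Qed.

(** * The involution on descent sets *)

(** Positivity of [a] makes [n] even, so that ['C(n, 3)] is even, and keeps [3] distinct from the
    sums of two of the powers. *)
Lemma Cyclotomic_double_dvd_descent_poly p a b c n :
  prime p -> odd p -> 5 <= p -> 0 < a -> a < b -> b < c ->
  n = 2 ^ c + 2 ^ b + 2 ^ a -> n %% p = 1 ->
  1 < 2 ^ a %% p -> 1 < 2 ^ b %% p -> 1 < 2 ^ c %% p ->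
  (map_poly intr 'Phi_(2 * p) %| descent_poly n)%R.
Proof.
move=> pp po p5 a0 ab bc hn np ap bp cp.
have [ab' [ac' bc']] : a != b /\ a != c /\ b != c by split; [|split]; lia.
have a2 : 1 < 2 ^ a by rewrite -{1}(expn0 2) ltn_exp2l.
have b4 : 3 < 2 ^ b by rewrite -[4]/(2 ^ 2) leq_exp2l //; lia.
have c8 : 7 < 2 ^ c by rewrite -[8]/(2 ^ 3) leq_exp2l //; lia.
have even x : 0 < x -> odd (2 ^ x) = false by move=> x0; rewrite oddX gtn_eqF.
have [oa ob oc] : [/\ odd (2 ^ a) = false, odd (2 ^ b) = false & odd (2 ^ c) = false].
  by split; apply: even; lia.
have on : odd n = false by rewrite hn !oddD oa ob oc.
have n3 : 3 < n by lia.
have [na nb nc] : [/\ 2 ^ a < n, 2 ^ b < n & 2 ^ c < n] by split; lia.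
have [nab nac nbc] : [/\ 2 ^ a + 2 ^ b < n, 2 ^ a + 2 ^ c < n & 2 ^ b + 2 ^ c < n].
  by split; lia.
pose three := Ordinal n3; pose va := Ordinal na; pose vb := Ordinal nb.
pose vc := Ordinal nc; pose wab := Ordinal nab; pose wac := Ordinal nac.
pose wbc := Ordinal nbc.
pose beta (S : {set 'I_n}) := #|block_perms [:: 0; n] S|.
(* Two of the three sums agree on membership in [S], and the power they share is picked. If both
   tests fail, [wac] and [wbc] agree, whence [vc]. *)
pose pick (S : {set 'I_n}) :=
  if (wab \in S) == (wac \in S) then va
  else if (wab \in S) == (wbc \in S) then vb else vc.
pose phi S := toggle (toggle S (pick S)) three.
have pickE S : pick S = va \/ pick S = vb \/ pick S = vc.
  by rewrite /pick; case: ifP => _; [left|case: ifP; right; [left|right]].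
have ne2 x y z (w v : 'I_n) : x != y -> w = 2 ^ x + 2 ^ y :> nat -> v = 2 ^ z :> nat ->
    (w == v) = false.
  by move=> xy hw hv; rewrite -val_eqE /= hw hv eq_sym (negbTE (pow2_neqD _ xy)).
(* [phi] toggles only single powers and [3], never one of the three sums. Hence [pick] is constant
   on orbits of [phi], which makes [phi] an involution. *)
have phi_w S w : w \in [:: wab; wac; wbc] -> (w \in phi S) = (w \in S).
  move=> hw; rewrite !toggle_memE.
  have -> : (w == three) = false.
    by move: hw; rewrite !inE => /or3P[] /eqP->; rewrite -val_eqE /=; lia.
  have -> : (w == pick S) = false; last by rewrite !addbF.
  by move: hw (pickE S); rewrite !inE => /or3P[] /eqP-> [|[|]] ->;
    [apply: (@ne2 a b a)|apply: (@ne2 a b b)|apply: (@ne2 a b c)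
    |apply: (@ne2 a c a)|apply: (@ne2 a c b)|apply: (@ne2 a c c)
    |apply: (@ne2 b c a)|apply: (@ne2 b c b)|apply: (@ne2 b c c)].
have phi_pick S : pick (phi S) = pick S.
  by rewrite /pick !phi_w // !inE eqxx ?orbT.
have pick0 S : 0 < pick S by case: (pickE S) => [|[|]] -> /=; lia.
apply: (@dvdp_sum_involution _ _ phi).
- by move=> S; rewrite {1}/phi phi_pick /phi (toggleC _ three) !toggleK.
- by move=> S; rewrite /phi !toggle_positions.
move=> S Spos; rewrite !descent_betaE ?/phi ?toggle_positions // -/(phi S).
have pC R (j : 'I_n) : 1 < j %% p -> p %| beta R + beta (toggle R j).
  move=> jp; have j0 : 0 < j by rewrite lt0n; apply: contraTneq jp => ->; rewrite mod0n.
  by apply: dvdn_block_perms1_toggle => //; apply: dvdn_bin_mod; rewrite ?np.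
apply: Cyclotomic_double_dvdD => //.
  have h1 : p %| beta S + beta (toggle S (pick S)).
    by apply: pC; case: (pickE S) => [|[|]] ->.
  have h2 : p %| beta (toggle S (pick S)) + beta (phi S).
    by apply: (pC _ three); rewrite /= modn_small; lia.
  (* Both sums vanish modulo [p]; cancelling their common term compares [beta S] with
     [beta (phi S)]. *)
  have h : beta S + beta (toggle S (pick S)) =
      beta (toggle S (pick S)) + beta (phi S) %[mod p].
    by rewrite (eqP h1) (eqP h2).
  by apply/eqP; rewrite -(eqn_modDl (beta (toggle S (pick S)))) addnC; apply/eqP.
have d3 : 2 %| beta (toggle S (pick S)) + beta (phi S).
  by apply: dvdn_block_perms1_toggle => //; apply: dvdn_bin_mod; rewrite // !modn2 on.
have -> : odd #|block_perms [:: 0; n] (phi S)| = odd (beta (toggle S (pick S))).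
  move: d3; rewrite dvdn2 oddD -/(beta (phi S)).
  by do 2! case: (odd _).
suff -> : odd (beta (toggle S (pick S))) = ~~ odd (beta S) by case: (odd _).
have hn' : [/\ n = 2 ^ a + 2 ^ b + 2 ^ c, n = 2 ^ b + 2 ^ a + 2 ^ c
    & n = 2 ^ c + 2 ^ a + 2 ^ b] by split; lia.
have [na' nb' nc'] := hn'; have ba' : b != a by rewrite eq_sym.
have [ca' cb'] : c != a /\ c != b by rewrite ![c == _]eq_sym.
have Ea := @odd_block_perms1_toggle n a b c S va wab wac
  na' ab' ac' bc' erefl erefl erefl.
have Eb := @odd_block_perms1_toggle n b a c S vb wab wbc
  nb' ba' bc' ac' erefl (addnC _ _) erefl.
have Ec := @odd_block_perms1_toggle n c a b S vc wac wbc
  nc' ca' cb' ab' erefl (addnC _ _) (addnC _ _).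
rewrite -addbT /beta /pick; case: eqP => [e|/eqP ne].
  by rewrite Ea e addbb.
case: eqP => [e|/eqP ne']; first by rewrite Eb e addbb.
by rewrite Ec; move: ne ne'; do 3! case: (_ \in S).
Qed.

Local Open Scope ring_scope.


Theorem theorem6p4 (p : nat) (hp : prime p) (hodd : odd p) (hp5 : (5 <= p)%N)
    (u : {unit 'Z_p}) (hu : val u = 2%:R) (g : nat) (hg : g = #[u]%g)
    (a b c n : nat) (hab : (a < b)%N) (hbc : (b < c)%N)
    (hn : n = (2 ^ c + 2 ^ b + 2 ^ a)%N)
    (habc : perm_eq [seq (x %% g)%N | x <- [:: a; b; c]]
                    [seq (x %% g)%N | x <- [:: (g - 2)%N; (g - 2)%N; (g - 1)%N]]) :
  [/\ nonessential p n (2 ^ c), nonessential p n (2 ^ b)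
    & nonessential p n (2 ^ a)] /\
  (nonessential 2 n 3 /\ nonessential p n 3) /\
  map_poly intr 'Phi_(2 * p) %| descent_poly n.
Proof.
have p1 : (1 < p)%N := prime_gt1 hp.
have g2 : (2 < g)%N by rewrite hg; exact: order2_gt2 hp5 hu.
have res r x : (0 < r <= 2)%N -> (x %% g = (g - r) %% g)%N ->
    (2 ^ r * 2 ^ x = 1 %[mod p])%N /\ (1 < 2 ^ x %% p)%N.
  move=> r12; rewrite (modn_small (_ : g - r < g)%N) => [xg|]; last by lia.
  suff e : (2 ^ r * 2 ^ x = 1 %[mod p])%N.
    by split=> //; exact: modn_expn2_gt1 e.
  by move: xg; rewrite hg => /(expn2_mod_order p1 hu) -> //; rewrite -hg; lia.
have res2 := @res 2 _ isT; have res1 := @res 1 _ isT.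
have [np [ap bp cp] a0] :
    [/\ (n %% p = 1)%N, [/\ 1 < 2 ^ a %% p, 1 < 2 ^ b %% p & 1 < 2 ^ c %% p]%N
      & (0 < a)%N].
  (* As [g > 2], neither [g - 2] nor [g - 1] is [0] modulo [g]. *)
  have a0 : (a %% g = (g - 2) %% g)%N \/ (a %% g = (g - 1) %% g)%N -> (0 < a)%N.
    by rewrite lt0n => h; apply/eqP => a0; move: h; rewrite a0 mod0n !modn_small; lia.
  case: (perm_eq_two_one habc) => -[] => [ha hb hc|ha hc hb|hb hc ha].
  - have [ha' ha2] := res2 _ ha; have [hb' hb2] := res2 _ hb; have [hc' hc2] := res1 _ hc.
    split; [|by []|by apply: a0; left].
    by rewrite hn addnC addnA addnAC; exact: modn_eq1_of_residues.
  - have [ha' ha2] := res2 _ ha; have [hb' hb2] := res1 _ hb; have [hc' hc2] := res2 _ hc.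
    split; [|by []|by apply: a0; left].
    by rewrite hn addnAC; exact: modn_eq1_of_residues.
  - have [ha' ha2] := res1 _ ha; have [hb' hb2] := res2 _ hb; have [hc' hc2] := res2 _ hc.
    split; [|by []|by apply: a0; right].
    by rewrite hn; exact: modn_eq1_of_residues.
have pow_gt0 x : (0 < 2 ^ x)%N by rewrite expn_gt0.
have [pa pb pc] := And3 (pow_gt0 a) (pow_gt0 b) (pow_gt0 c).
have a2 : (2 <= 2 ^ a)%N by rewrite -{1}(expn1 2) leq_exp2l.
have b2 : (2 ^ a < 2 ^ b)%N by rewrite ltn_exp2l.
split; last split.
(* The lowest base-[p] digit of [n] is [1], while that of each power exceeds [1]. *)
- by split; apply: nonessential_digit0; rewrite ?np //; lia.
- split; apply: nonessential_digit0; try lia.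
    by rewrite hn !modn2 !oddD !oddX /= !orbF !gtn_eqF //; lia.
  by rewrite np modn_small; lia.
- exact: Cyclotomic_double_dvd_descent_poly hn np ap bp cp.
Qed.
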